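(* Let $X\overset{f}{\leftarrow}Z\overset{g}{\rightarrow}Y$ be a minimal correspondence of curves over a field $k$ without a core, where $Z$ is hyperbolic or $k$ is an algebraic closure of $\mathbb{F}_p$ for some prime $p$. Suppose the generic graph $\mathcal{G}_{gen}$ is a tree. Then the natural map $$G_P *_{G_{PQ}} G_Q\longrightarrow A^{PQ}$$ induced by the inclusions of $G_P$ and $G_Q$ is an isomorphism of topological groups.
   Context: A curve over a field $k$ is a smooth, geometrically integral $k$-scheme (separated, of finite type) of dimension 1; it is hyperbolic if $\mathrm{Aut}_{\overline{k}}(C_{\overline{k}})$ is finite (equivalently $2g-2+r\ge 1$ with $g$ the genus of the compactification and $r$ the number of geometric punctures). A correspondence of curves over $k$ is a diagram $X\overset{f}{\leftarrow}Z\overset{g}{\rightarrow}Y$ of curves over $k$ with $f,g$ finite, generically separable. Via $f^*,g^*$ regard $k(X),k(Y)\subset k(Z)$. It is minimal if no proper subfield of $k(Z)$ contains both $k(X)$ and $k(Y)$. It is without a core if $k(X)\cap k(Y)$ has transcendence degree 0 over $k$. Let $\Omega$ be an algebraically closed field of transcendence degree 1 over $k$. The full generic graph $\mathcal{G}_{gen}^{full}$ is the 2-colored graph whose blue vertices are the $k$-algebra embeddings $k(X)\to\Omega$, whose red vertices are the $k$-algebra embeddings $k(Y)\to\Omega$, and whose edges are the $k$-algebra embeddings $e:k(Z)\to\Omega$, where $e$ joins the blue vertex $e\circ f^*$ to the red vertex $e\circ g^*$. Fix a $k$-embedding $PQ:k(Z)\hookrightarrow\Omega$, and put $P=PQ\circ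 f^*$ (blue vertex), $Q=PQ\circ g^*$ (red vertex). The generic graph $\mathcal{G}_{gen}$ is the connected component of $\mathcal{G}_{gen}^{full}$ containing the edge $PQ$. $E_\infty\subset\Omega$ is the smallest subfield of $\Omega$ containing $PQ(k(Z))$ that is Galois (possibly infinite) over both $P(k(X))$ and $Q(k(Y))$; equivalently, it is the compositum in $\Omega$ of the images of all vertices and edges of $\mathcal{G}_{gen}$. Put $G_P=\mathrm{Gal}(E_\infty/P(k(X)))$, $G_Q=\mathrm{Gal}(E_\infty/Q(k(Y)))$, $G_{PQ}=\mathrm{Gal}(E_\infty/PQ(k(Z)))$. $A^{PQ}$ is the subgroup of $\mathrm{Aut}_k(E_\infty)$ generated by $G_P$ and $G_Q$, with the topology induced from $\mathrm{Aut}_k(E_\infty)$, in which the pointwise stabilizers of finite subsets of $E_\infty$ form a neighborhood base of the identity. The group $G_{PQ}$ is open in both profinite groups $G_P$ and $G_Q$, and the amalgamated product $G_P*_{G_{PQ}}G_Q$ carries the natural group topology generated by those of $G_P$ and $G_Q$, i.e. the one for which $G_P$ and $G_Q$ (with their profinite topologies) are open subgroups. *)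

(* Defs.v *)
From HB Require Import structures.
From Stdlib Require List.
From mathcomp Require Import all_boot all_order all_algebra all_field.
From mathcomp Require Import all_classical all_analysis.

Set Implicit Arguments.
Unset Strict Implicit.
Unset Printing Implicit Defensive.

Import GRing.Theory.
Local Open Scope classical_set_scope.
Local Open Scope ring_scope.

Record opens (T : topologicalType) := Opens {
  oset :> set T;
  oset_open : open oset }.

Definition fullo (T : topologicalType) : opens T := Opens (@openT T).

Record ringedSpace := RingedSpace {
  rs_space :> topologicalType;
  sec : opens rs_space -> comPzRingType;
  res : forall U V : opens rs_space, V `<=` U -> {rmorphism sec U -> sec V};
  res_id : forall (U : opens rs_space) (h : U `<=` U) s, res h s = s;
  res_comp : forall (U V W : opens rs_space) (hVU : V `<=` U) (hWV : W `<=` V)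
    (hWU : W `<=` U) s, res hWV (res hVU s) = res hWU s;
  sheafP : forall (U : opens rs_space) (I : Type) (V : I -> opens rs_space)
    (hV : forall i, V i `<=` U), U `<=` \bigcup_i V i ->
    forall s : (forall i, sec (V i)),
    (forall i j (W : opens rs_space) (hi : W `<=` V i) (hj : W `<=` V j),
       res hi (s i) = res hj (s j)) ->
    exists! t, forall i, res (hV i) t = s i }.

Section LocallyRinged.
Variable X : ringedSpace.
Implicit Types U V W : opens X.

(* The germ of [s] at [x] is a unit of the stalk at [x]. *)
Definition unit_at U (s : sec U) (x : X) : Prop :=
  exists V (h : V `<=` U), oset V x /\ exists t, res h s * t = 1.

Definition locally_ringed : Prop :=
  forall U (x : X), oset U x ->
    ~ unit_at (0 : sec U) x /\
    forall s t : sec U, unit_at (s + t) x -> unit_at s x \/ unit_at t x.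

Definition prime_ideal (A : comPzRingType) (p : set A) : Prop :=
  [/\ p 0, forall a b, p a -> p b -> p (a + b), forall a b, p b -> p (a * b),
      ~ p 1 & forall a b, p (a * b) -> p a \/ p b].

(* The canonical map from [U] to the prime spectrum of [sec U] is an
   isomorphism: it is bijective, the loci [D(s)] where a section is a unit form
   a base of the topology of [U], and the ring of sections over [D(s)] is the
   localization of [sec U] at [s]. *)
Definition affine_open U : Prop :=
  [/\ forall p : set (sec U), prime_ideal p ->
        exists! x, oset U x /\ p = [set s | ~ unit_at s x],
      forall V (x : X), V `<=` U -> oset V x ->
        exists s : sec U, unit_at s x /\ [set y | oset U y /\ unit_at s y] `<=` V
    & forall (s : sec U) V (h : V `<=` U),
        oset V = [set y | oset U y /\ unit_at s y] ->
        (forall t : sec V, exists n a, res h a = t * res h s ^+ n) /\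
        (forall a : sec U, res h a = 0 -> exists n, s ^+ n * a = 0)].

Definition is_scheme : Prop :=
  locally_ringed /\ forall x : X, exists U, oset U x /\ affine_open U.

Definition integral_scheme : Prop :=
  (exists x : X, True) /\
  forall U, oset U !=set0 ->
    (1 : sec U) <> 0 /\ forall s t : sec U, s * t = 0 -> s = 0 \/ t = 0.

End LocallyRinged.

Definition preimo (X Y : topologicalType) (f : X -> Y)
    (cf : forall V, open V -> open (f @^-1` V)) (V : opens Y) : opens X :=
  Opens (cf V (@oset_open Y V)).

Lemma preimo_sub (X Y : topologicalType) (f : X -> Y)
    (cf : forall V, open V -> open (f @^-1` V)) (U V : opens Y) :
  V `<=` U -> preimo cf V `<=` preimo cf U.
Proof. by move=> h x /h. Qed.
Arguments preimo_sub {X Y f} cf {U V} _.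

Record mor (X Y : ringedSpace) := Mor {
  mfun :> X -> Y;
  mcont : forall V, open V -> open (mfun @^-1` V);
  msharp : forall V : opens Y, {rmorphism sec V -> sec (preimo mcont V)};
  mnat : forall (U V : opens Y) (h : V `<=` U) (s : sec U),
    res (preimo_sub mcont h) (msharp U s) = msharp V (res h s);
  mlocal : forall (V : opens Y) (s : sec V) (x : X), oset V (mfun x) ->
    unit_at (msharp V s) x -> unit_at s (mfun x) }.

Definition preim (X Y : ringedSpace) (f : mor X Y) : opens Y -> opens X :=
  preimo (@mcont X Y f).

Definition mor_eq (X Y : ringedSpace) (f g : mor X Y) : Prop :=
  (forall x, f x = g x) /\
  forall (V : opens Y) (s : sec V) (h : preim g V `<=` preim f V),
    res h (msharp f V s) = msharp g V s.

Section Composition.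
Variables (X Y Z : ringedSpace) (g : mor Y Z) (f : mor X Y).

Definition comp_cont (V : set Z) (oV : open V) : open ((g \o f) @^-1` V) :=
  mcont f (mcont g oV).

Definition comp_sharp (V : opens Z) :
    {rmorphism sec V -> sec (preimo comp_cont V)} :=
  msharp f (preim g V) \o msharp g V.

Fact comp_nat (U V : opens Z) (h : V `<=` U) (s : sec U) :
  res (preimo_sub comp_cont h) (comp_sharp U s) = comp_sharp V (res h s).
Proof.
rewrite /comp_sharp /= -mnat -mnat.
by congr (res _ _); exact: Prop_irrelevance.
Qed.

Fact comp_local (V : opens Z) (s : sec V) (x : X) :
  oset V ((g \o f) x) -> unit_at (comp_sharp V s) x -> unit_at s ((g \o f) x).
Proof. by move=> Vx /(mlocal (V := preim g V) Vx) /(mlocal Vx). Qed.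

Definition mcomp : mor X Z := Mor comp_nat comp_local.
End Composition.

Section Identity.
Variable X : ringedSpace.

Definition id_cont (V : set X) (oV : open V) : open (idfun @^-1` V) := oV.

Fact id_res_sub (V : opens X) : preimo id_cont V `<=` V.
Proof. by []. Qed.

Definition id_sharp (V : opens X) : {rmorphism sec V -> sec (preimo id_cont V)} :=
  res (@id_res_sub V).

Fact id_nat (U V : opens X) (h : V `<=` U) (s : sec U) :
  res (preimo_sub id_cont h) (id_sharp U s) = id_sharp V (res h s).
Proof.
have h' : preimo id_cont V `<=` U by move=> x /h.
by rewrite /id_sharp (res_comp _ _ h') (res_comp _ _ h').
Qed.

Fact id_local (V : opens X) (s : sec V) (x : X) :
  oset V (idfun x) -> unit_at (id_sharp V s) x -> unit_at s (idfun x).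
Proof.
move=> Vx [W [h [Wx [t st]]]]; have h' : W `<=` V by [].
by exists W, h'; split=> //; exists t; rewrite -st /id_sharp (res_comp _ _ h').
Qed.

Definition mid : mor X X := Mor id_nat id_local.
End Identity.

Record kScheme (k : fieldType) := KScheme {
  ks_space :> ringedSpace;
  ks_scheme : is_scheme ks_space;
  str : forall U : opens ks_space, {rmorphism k -> sec U};
  str_res : forall (U V : opens ks_space) (h : V `<=` U) a,
    res h (str U a) = str V a }.
Arguments str {k} X U : rename.

(* [f] lies over the morphism of spectra of fields given by [iota]. *)
Definition mor_over (k K : fieldType) (iota : {rmorphism k -> K})
    (X' : kScheme K) (X : kScheme k) (f : mor X' X) : Prop :=
  forall (U : opens X) a, msharp f U (str X U a) = str X' (preim f U) (iota a).

Definition kmor (k : fieldType) (X Y : kScheme k) (f : mor X Y) : Prop :=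
  mor_over idfun f.

Section Notions.
Variable k : fieldType.
Implicit Types X Y Z P : kScheme k.

Definition is_base_change (K : fieldType) (iota : {rmorphism k -> K})
    X (X' : kScheme K) (p : mor X' X) : Prop :=
  mor_over iota p /\
  forall (T : kScheme K) (q : mor T X), mor_over iota q ->
    (exists u : mor T X', kmor u /\ mor_eq (mcomp p u) q) /\
    forall u v : mor T X', kmor u -> kmor v ->
      mor_eq (mcomp p u) q -> mor_eq (mcomp p v) q -> mor_eq u v.

Definition geometrically_integral X : Prop :=
  forall (K : fieldType) (iota : {rmorphism k -> K}) (X' : kScheme K)
    (p : mor X' X), is_base_change iota p -> integral_scheme X'.

Definition is_product X Y P (p1 : mor P X) (p2 : mor P Y) : Prop :=
  [/\ kmor p1, kmor p2 &
  forall (T : kScheme k) (q1 : mor T X) (q2 : mor T Y), kmor q1 -> kmor q2 ->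
    (exists u : mor T P,
       [/\ kmor u, mor_eq (mcomp p1 u) q1 & mor_eq (mcomp p2 u) q2]) /\
    forall u v : mor T P, kmor u -> kmor v ->
      mor_eq (mcomp p1 u) q1 -> mor_eq (mcomp p2 u) q2 ->
      mor_eq (mcomp p1 v) q1 -> mor_eq (mcomp p2 v) q2 -> mor_eq u v].

Definition closed_immersion X Y (f : mor X Y) : Prop :=
  [/\ injective f, forall C : set X, closed C -> closed (f @` C) &
  (* surjectivity on stalks *)
  forall (V : opens X) (t : sec V) (x : X), oset V x ->
    exists (W : opens Y) (s : sec W) (U : opens X) (h : U `<=` preim f W)
      (h' : U `<=` V), oset U x /\ res h (msharp f W s) = res h' t].

Definition separated_scheme X : Prop :=
  forall (P : kScheme k) (p1 p2 : mor P X) (d : mor X P), is_product p1 p2 -> kmor d ->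
    mor_eq (mcomp p1 d) (mid X) -> mor_eq (mcomp p2 d) (mid X) ->
    closed_immersion d.

Definition fg_algebra (A : comPzRingType) (i : {rmorphism k -> A}) : Prop :=
  exists l : seq A, forall S : set A,
    S 1 -> (forall x y, S x -> S y -> S (x - y)) ->
    (forall x y, S x -> S y -> S (x * y)) ->
    (forall a, S (i a)) -> (forall x, x \in l -> S x) -> forall x, S x.

Definition finite_type X : Prop :=
  compact [set: X] /\
  forall x : X, exists U, [/\ oset U x, affine_open U & fg_algebra (str X U)].

Definition formally_smooth (A : comPzRingType) (i : {rmorphism k -> A}) : Prop :=
  forall (B C : comPzRingType) (j : {rmorphism k -> B}) (pi : {rmorphism B -> C}),
    (forall c, exists b, pi b = c) ->
    (forall x y, pi x = 0 -> pi y = 0 -> x * y = 0) ->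
    forall u : {rmorphism A -> C}, (forall a, u (i a) = pi (j a)) ->
    exists v : {rmorphism A -> B},
      (forall a, v (i a) = j a) /\ (forall x, pi (v x) = u x).

(* A finitely generated algebra over a field is finitely presented, so this is
   smoothness of the ring of sections over [k]. *)
Definition smooth_scheme X : Prop :=
  forall x : X, exists U, [/\ oset U x, affine_open U,
    fg_algebra (str X U) & formally_smooth (str X U)].

End Notions.

Section Dimension.
Variable T : topologicalType.

Definition irreducible_closed (Z : set T) : Prop :=
  [/\ closed Z, Z !=set0 &
  forall A B, closed A -> closed B -> Z `<=` A `|` B -> Z `<=` A \/ Z `<=` B].

Definition closed_chain (n : nat) (Z : nat -> set T) : Prop :=
  (forall i, (i <= n)%N -> irreducible_closed (Z i)) /\
  forall i, (i < n)%N -> Z i `<` Z i.+1.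

Definition krull_dim (n : nat) : Prop :=
  (exists Z, closed_chain n Z) /\ ~ (exists Z, closed_chain n.+1 Z).
End Dimension.

Definition is_curve (k : fieldType) (X : kScheme k) : Prop :=
  [/\ separated_scheme X, finite_type X, smooth_scheme X,
      geometrically_integral X & krull_dim X 1].

Definition finite_mor (X Y : ringedSpace) (f : mor X Y) : Prop :=
  forall V : opens Y, affine_open V ->
    affine_open (preim f V) /\
    exists s : seq (sec (preim f V)), forall t,
      exists c : 'I_(size s) -> sec V,
        t = \sum_(i < size s) msharp f V (c i) * s`_i.

Definition is_subfield (L : fieldType) (S : set L) : Prop :=
  [/\ S 1, forall x y, S x -> S y -> S (x - y)
         & forall x y, S x -> S y -> S (x / y)].

Record subfield (L : fieldType) := Subfield {
  sf_set :> set L;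
  sf_subfield : is_subfield sf_set }.

Definition sf_pred (L : fieldType) (F : subfield L) : pred L :=
  fun x => x \in sf_set F.

Fact sf_divring_closed (L : fieldType) (F : subfield L) :
  divring_closed (sf_pred F).
Proof.
case: F => S [S1 SB SD]; split; rewrite /in_mem /= /sf_pred /=.
- exact: mem_set.
- by move=> x y /set_mem Sx /set_mem Sy; apply/mem_set/SB.
- by move=> x y /set_mem Sx /set_mem Sy; apply/mem_set/SD.
Qed.

Definition sf_elt (L : fieldType) (F : subfield L) := {x : L | sf_pred F x}.

HB.instance Definition _ (L : fieldType) (F : subfield L) :=
  SubChoice.on (sf_elt F).
HB.instance Definition _ (L : fieldType) (F : subfield L) :=
  GRing.SubChoice_isSubIntegralDomain.Build L (sf_pred F) (sf_elt F)
    (sf_divring_closed F).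
HB.instance Definition _ (L : fieldType) (F : subfield L) :=
  [SubIntegralDomain_isSubField of sf_elt F by <:].

Definition fimage (K L : fieldType) (e : {rmorphism K -> L}) : set L := range e.

Section Extensions.
Variable L : fieldType.
Implicit Types (F E S : set L) (x : L) (p : {poly L}).

Definition poly_over F p : Prop := forall i, F p`_i.

Definition algebraic_over F x : Prop :=
  exists p, [/\ poly_over F p, p != 0 & root p x].

Definition separable_over F x : Prop :=
  exists p, [/\ poly_over F p, separable_poly p & root p x].

Definition irreducible_over F p : Prop :=
  [/\ poly_over F p, (1 < size p)%N &
  forall q r, poly_over F q -> poly_over F r -> p = q * r ->
    size q = 1%N \/ size r = 1%N].

Definition splits_in E p : Prop :=
  exists s : seq L, (forall a, a \in s -> E a) /\ p %= \prod_(a <- s) ('X - a%:P).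

(* Galois theory in the library is restricted to finite extensions. *)
Definition is_galois F E : Prop :=
  [/\ F `<=` E, forall x, E x -> separable_over F x &
  forall p x, irreducible_over F p -> E x -> root p x -> splits_in E p].

Definition gen_field S : set L := smallest (@is_subfield L) S.

(* [F] has a transcendence basis [t] with [n] elements over the subfield [k0];
   independence is stated as no [t i] being algebraic over the others. *)
Definition has_trdeg (k0 F : set L) (n : nat) : Prop :=
  exists t : 'I_n -> L,
    [/\ forall i, F (t i),
        forall i, ~ algebraic_over
          (gen_field (k0 `|` [set t j | j in [set j | j <> i]])) (t i)
      & forall x, F x -> algebraic_over (gen_field (k0 `|` range t)) x].

Definition galois_hull_set (F1 F2 M : set L) : set L :=
  smallest (fun E => [/\ is_subfield E, is_galois F1 E & is_galois F2 E]) M.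

Fact galois_hull_subfield F1 F2 M : is_subfield (galois_hull_set F1 F2 M).
Proof.
split.
- by move=> E [[[]]].
- by move=> x y Ex Ey E HE; have [[[_ + _] _ _] _] := HE; apply;
    [exact: Ex | exact: Ey].
- by move=> x y Ex Ey E HE; have [[[_ _ +] _ _] _] := HE; apply;
    [exact: Ex | exact: Ey].
Qed.

Definition galois_hull F1 F2 M : subfield L :=
  Subfield (galois_hull_subfield F1 F2 M).

End Extensions.

Definition is_algebraic_closure (K L : fieldType) (i : {rmorphism K -> L}) : Prop :=
  GRing.closed_field_axiom L /\ forall x, algebraic_over (fimage i) x.

Definition kaut (k : fieldType) (X : kScheme k) (u : mor X X) : Prop :=
  kmor u /\ exists v : mor X X,
    [/\ kmor v, mor_eq (mcomp u v) (mid X) & mor_eq (mcomp v u) (mid X)].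

Definition hyperbolic (k : fieldType) (X : kScheme k) : Prop :=
  forall (kbar : fieldType) (i : {rmorphism k -> kbar}) (X' : kScheme kbar)
    (p : mor X' X), is_algebraic_closure i -> is_base_change i p ->
  exists n (v : 'I_n -> mor X' X'), forall u, kaut u -> exists j, mor_eq u (v j).

(* The stalk at the generic point, as the direct limit of the rings of sections
   over the nonempty open subsets; meaningful for irreducible [X]. *)
Record function_field (k : fieldType) (X : kScheme k) := FunctionField {
  ff_field :> fieldType;
  germ : forall U : opens X, oset U !=set0 -> {rmorphism sec U -> ff_field};
  germ_res : forall (U V : opens X) (nU : oset U !=set0)
    (nV : oset V !=set0) (h : V `<=` U) s, germ nV (res h s) = germ nU s;
  germ_surj : forall z : ff_field,
    exists (U : opens X) (nU : oset U !=set0) (s : sec U), z = germ nU s;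
  germ_eq0 : forall (U : opens X) (nU : oset U !=set0) (s : sec U),
    germ nU s = 0 ->
    exists (V : opens X) (h : V `<=` U), oset V !=set0 /\ res h s = 0 }.

Section Constants.
Variables (k : fieldType) (X : kScheme k) (KX : function_field X).

Fact fullo_neq0 : (fullo X : set X) !=set0.
Proof. by have [U [[x _] _]] := germ_surj (0 : KX); exists x. Qed.

Definition ff_const : {rmorphism k -> KX} :=
  germ KX fullo_neq0 \o str X (fullo X).
End Constants.

(* [phi] is the map on function fields induced by [f]; in particular [f] is
   dominant. *)
Definition is_pullback (k : fieldType) (X Y : kScheme k) (f : mor X Y)
    (KX : function_field X) (KY : function_field Y) (phi : {rmorphism KY -> KX}) :=
  forall (V : opens Y) (nV : oset V !=set0),
  exists nU : (preim f V : set X) !=set0,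
  forall s, germ KX nU (msharp f V s) = phi (germ KY nV s).

Lemma pullback_const (k : fieldType) (X Y : kScheme k) (f : mor X Y)
    (KX : function_field X) (KY : function_field Y) (phi : {rmorphism KY -> KX}) :
  kmor f -> is_pullback f phi -> forall a, phi (ff_const KY a) = ff_const KX a.
Proof.
move=> kf pb a; have [nU H] := pb _ (fullo_neq0 KY).
rewrite /ff_const /= -H kf /=.
have h : preim f (fullo Y) `<=` fullo X by [].
by rewrite -(str_res h) (@germ_res _ _ KX _ _ (fullo_neq0 KX) nU h).
Qed.

Record correspondence (k : fieldType) := Correspondence {
  cX : kScheme k; cY : kScheme k; cZ : kScheme k;
  cX_curve : is_curve cX; cY_curve : is_curve cY; cZ_curve : is_curve cZ;
  cf : mor cZ cX; cg : mor cZ cY;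
  cf_kmor : kmor cf; cg_kmor : kmor cg;
  cf_finite : finite_mor cf; cg_finite : finite_mor cg;
  kX : function_field cX; kY : function_field cY; kZ : function_field cZ;
  fstar : {rmorphism kX -> kZ}; gstar : {rmorphism kY -> kZ};
  fstarP : is_pullback cf fstar; gstarP : is_pullback cg gstar;
  cf_gen_separable : forall z, separable_over (fimage fstar) z;
  cg_gen_separable : forall z, separable_over (fimage gstar) z }.

Section Correspondences.
Variables (k : fieldType) (C : correspondence k).

Definition minimal : Prop :=
  forall F : set (kZ C), is_subfield F ->
    fimage (@fstar _ C) `<=` F -> fimage (@gstar _ C) `<=` F -> F = setT.

Definition without_core : Prop :=
  has_trdeg (fimage (ff_const (kZ C)))
    (fimage (@fstar _ C) `&` fimage (@gstar _ C)) 0.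
End Correspondences.

Record bigraph := Bigraph {
  blue : Type;
  red : Type;
  edge : Type;
  bend : edge -> blue;
  rend : edge -> red }.

Section Graphs.
Variable G : bigraph.

Definition vertex : Type := (blue G + red G)%type.

(* An edge with an orientation: [true] from its blue end to its red end. *)
Definition dart : Type := (edge G * bool)%type.

Definition dsrc (d : dart) : vertex :=
  if d.2 then inl (bend d.1) else inr (rend d.1).
Definition dtgt (d : dart) : vertex :=
  if d.2 then inr (rend d.1) else inl (bend d.1).

Fixpoint walk (u : vertex) (p : seq dart) (v : vertex) : Prop :=
  if p is d :: p' then dsrc d = u /\ walk (dtgt d) p' v else u = v.

Definition connected_to (u v : vertex) : Prop := exists p, walk u p v.

(* Two distinct edges with the same ends form a circuit of length 2. *)
Definition circuit (p : seq dart) : Prop :=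
  [/\ p <> [::], exists u, walk u p u,
      List.NoDup [seq dsrc d | d <- p] & List.NoDup [seq d.1 | d <- p]].

Definition is_tree : Prop :=
  [/\ inhabited vertex, forall u v, connected_to u v & forall p, ~ circuit p].

Variable e0 : edge G.
Let comp (u : vertex) : Prop := connected_to (inl (bend e0)) u.

Fact comp_rend (e : edge G) : comp (inl (bend e)) -> comp (inr (rend e)).
Proof.
rewrite /comp => -[p]; move: (inl (bend e0)) => u hp.
exists (rcons p (e, true)); elim: p u hp => [|d p IH] u /=; first by move=> ->.
by case=> -> /IH.
Qed.

Definition component : bigraph :=
  @Bigraph {b : blue G | comp (inl b)} {r : red G | comp (inr r)}
    {e : edge G | comp (inl (bend e))}
    (fun e => exist _ (bend (sval e)) (svalP e))
    (fun e => exist _ (rend (sval e)) (comp_rend (svalP e))).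
End Graphs.

Record kemb (k K L : fieldType) (i : {rmorphism k -> K}) (j : {rmorphism k -> L}) :=
  Kemb { kemb_fun :> {rmorphism K -> L}; kembP : forall a, kemb_fun (i a) = j a }.

Section GenericGraph.
Variables (k : fieldType) (C : correspondence k).
Variables (Omega : fieldType) (j : {rmorphism k -> Omega}).

Let embX := kemb (ff_const (kX C)) j.
Let embY := kemb (ff_const (kY C)) j.
Let embZ := kemb (ff_const (kZ C)) j.

Fact bend_const (e : embZ) a : (e \o @fstar _ C) (ff_const (kX C) a) = j a.
Proof. by rewrite /= (pullback_const (@cf_kmor _ C) (@fstarP _ C)) kembP. Qed.

Fact rend_const (e : embZ) a : (e \o @gstar _ C) (ff_const (kY C) a) = j a.
Proof. by rewrite /= (pullback_const (@cg_kmor _ C) (@gstarP _ C)) kembP. Qed.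

Definition blue_end (e : embZ) : embX := Kemb (bend_const e).
Definition red_end (e : embZ) : embY := Kemb (rend_const e).

Definition Ggen_full : bigraph := Bigraph blue_end red_end.

Definition Ggen (PQ : embZ) : bigraph := @component Ggen_full PQ.

Definition Einf (PQ : embZ) : subfield Omega :=
  galois_hull (fimage (blue_end PQ)) (fimage (red_end PQ)) (fimage PQ).
End GenericGraph.

HB.mixin Record Group_Topological_isTopGroup G of Group G & Topological G := {
  mulg_continuous : continuous (fun p : G * G => (p.1 * p.2)%g);
  invg_continuous : continuous (fun x : G => (x^-1)%g) }.

#[short(type="topGroupType")]
HB.structure Definition TopGroup :=
  {G of Group_Topological_isTopGroup G & Group G & Topological G}.

Definition open_embedding (S T : topologicalType) (f : S -> T) : Prop :=
  [/\ injective f, continuous f & forall U : set S, open U -> open (f @` U)].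

Definition homeomorphism (S T : topologicalType) (f : S -> T) : Prop :=
  [/\ bijective f, continuous f & forall U : set S, open U -> open (f @` U)].

Record subgroup (G : groupType) := Subgroup {
  sg_set :> set G;
  sg1 : sg_set 1%g;
  sgF : forall x y, sg_set x -> sg_set y -> sg_set (x / y)%g }.

Definition sg_pred (G : groupType) (H : subgroup G) : pred G :=
  fun x => x \in sg_set H.

Definition sg_elt (G : groupType) (H : subgroup G) := {x : G | sg_pred H x}.

Fact sg_group_closed (G : groupType) (H : subgroup G) : group_closed (sg_pred H).
Proof.
case: H => S S1 SF; split; rewrite /in_mem /= /sg_pred /=; first exact: mem_set.
by move=> x y /set_mem Sx /set_mem Sy; apply/mem_set/SF.
Qed.

HB.instance Definition _ (G : groupType) (H : subgroup G) :=
  SubChoice.on (sg_elt H).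
HB.instance Definition _ (G : groupType) (H : subgroup G) :=
  SubChoice_isSubGroup.Build G (sg_pred H) (sg_elt H) (sg_group_closed H).

HB.instance Definition _ (G : topGroupType) (H : subgroup G) :=
  Topological.copy (sg_elt H) (initial_topology (val : sg_elt H -> G)).

Section SubgroupTopology.
Variables (G : topGroupType) (H : subgroup G).
Let f : sg_elt H -> G := val.

Fact sg_open (U : set (sg_elt H)) : open U = exists2 V, open V & f @^-1` V = U.
Proof. by []. Qed.

Fact sg_cvg (T : Type) (F : set_system T) (g : T -> sg_elt H) (x : sg_elt H) :
  Filter F -> (f \o g) @ F --> f x -> g @ F --> x.
Proof.
move=> FF cv A; rewrite nbhsE => -[U [oU Ux] UA].
move: oU; rewrite sg_open => -[V oV VU].
rewrite -VU in Ux UA; have /cv FV : nbhs (f x) V by exact: open_nbhs_nbhs.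
by apply: (@filterS _ F FF _ _ _ FV) => t Vt; exact: UA.
Qed.

Fact sg_val_continuous : continuous f.
Proof. exact: initial_continuous. Qed.

Fact sg_mulg_continuous :
  continuous (fun p : sg_elt H * sg_elt H => (p.1 * p.2)%g).
Proof.
move=> -[x y]; apply: sg_cvg.
apply: (@cvg_comp _ _ _ (fun p : sg_elt H * sg_elt H => (f p.1, f p.2))
          (fun p : G * G => (p.1 * p.2)%g) _ (nbhs (f x, f y)));
  last exact: (@mulg_continuous G (f x, f y)).
apply: cvg_pair.
- by apply: (@cvg_comp _ _ _ fst f); [exact: cvg_fst | exact: sg_val_continuous].
- by apply: (@cvg_comp _ _ _ snd f); [exact: cvg_snd | exact: sg_val_continuous].
Qed.

Fact sg_invg_continuous : continuous (fun x : sg_elt H => (x^-1)%g).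
Proof.
move=> x; apply: (@sg_cvg _ (nbhs x)).
exact: (cvg_comp _ _ (@sg_val_continuous x) (@invg_continuous G (f x))).
Qed.

HB.instance Definition _ := Group_Topological_isTopGroup.Build (sg_elt H)
  sg_mulg_continuous sg_invg_continuous.
End SubgroupTopology.

Section GeneratedSubgroup.
Variables (G : groupType) (S : set G).

Definition gen_subgroup_set : set G :=
  smallest (fun H : set G => H 1%g /\ forall x y, H x -> H y -> H (x / y)%g) S.

Fact gen_subgroup1 : gen_subgroup_set 1%g.
Proof. by move=> H [[]]. Qed.

Fact gen_subgroupF x y :
  gen_subgroup_set x -> gen_subgroup_set y -> gen_subgroup_set (x / y)%g.
Proof. by move=> Hx Hy H HS; apply: (HS.1.2); [exact: Hx|exact: Hy]. Qed.

Definition gen_subgroup : subgroup G := Subgroup gen_subgroup1 gen_subgroupF.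
End GeneratedSubgroup.

Record fieldAut (E : fieldType) (F : set E) := FieldAut {
  aut_fun :> {rmorphism E -> E};
  aut_inv : {rmorphism E -> E};
  aut_funK : cancel aut_fun aut_inv;
  aut_invK : cancel aut_inv aut_fun;
  aut_fix : forall x, F x -> aut_fun x = x }.

Lemma rmorphism_ext (R S : pzSemiRingType) (f g : {rmorphism R -> S}) :
  f =1 g -> f = g.
Proof.
case: f => f cf; case: g => g cg /= /funext fg; subst g; congr GRing.RMorphism.Pack.
case: cf => -[a] [b]; case: cg => -[a'] [b'].
by rewrite (Prop_irrelevance a a') (Prop_irrelevance b b').
Qed.

Section FieldAut.
Variables (E : fieldType) (F : set E).
Implicit Types s t : fieldAut F.

Lemma fieldAut_ext s t : s =1 t -> s = t.
Proof.
case: s => f f' fK f'K ff; case: t => g g' gK g'K gf /= /rmorphism_ext fg.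
subst g; have /rmorphism_ext fg' : f' =1 g' by move=> x; rewrite -{1}(g'K x) fK.
by subst g'; congr FieldAut; exact: Prop_irrelevance.
Qed.

Definition fieldAut1 : fieldAut F :=
  @FieldAut E F idfun idfun (fun=> erefl) (fun=> erefl) (fun _ _ => erefl).

Fact fieldAutM_fix s t x : F x -> (s \o t) x = x.
Proof. by move=> Fx /=; rewrite !aut_fix. Qed.

Definition fieldAutM s t : fieldAut F :=
  @FieldAut E F (s \o t) (aut_inv t \o aut_inv s)
    (can_comp (aut_funK s) (aut_funK t)) (can_comp (aut_invK t) (aut_invK s))
    (fieldAutM_fix s t).

Fact fieldAutV_fix s x : F x -> aut_inv s x = x.
Proof. by move=> Fx; rewrite -{1}(aut_fix s Fx) aut_funK. Qed.

Definition fieldAutV s : fieldAut F :=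
  @FieldAut E F (aut_inv s) s (aut_invK s) (aut_funK s) (@fieldAutV_fix s).

HB.instance Definition _ := gen_eqMixin (fieldAut F).
HB.instance Definition _ := gen_choiceMixin (fieldAut F).

Fact fieldAutMA : associative fieldAutM.
Proof. by move=> s t u; apply: fieldAut_ext. Qed.
Fact fieldAut1M : left_id fieldAut1 fieldAutM.
Proof. by move=> s; apply: fieldAut_ext. Qed.
Fact fieldAutM1 : right_id fieldAut1 fieldAutM.
Proof. by move=> s; apply: fieldAut_ext. Qed.
Fact fieldAutVM : left_inverse fieldAut1 fieldAutV fieldAutM.
Proof. by move=> s; apply: fieldAut_ext => x /=; exact: aut_funK. Qed.
Fact fieldAutMV : right_inverse fieldAut1 fieldAutV fieldAutM.
Proof. by move=> s; apply: fieldAut_ext => x /=; exact: aut_invK. Qed.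

HB.instance Definition _ := isGroup.Build (fieldAut F)
  fieldAutMA fieldAut1M fieldAutM1 fieldAutVM fieldAutMV.

(* The cosets of the pointwise stabilizers of finite subsets of [E] form a base
   of the topology; for [E] Galois over [F] this is the Krull topology. *)
Definition aut_open (U : set (fieldAut F)) : Prop :=
  forall s, U s -> exists l : seq E,
    forall t, (forall x, x \in l -> t x = s x) -> U t.

Fact aut_openT : aut_open setT.
Proof. by move=> s _; exists [::]. Qed.

Fact aut_openI : setI_closed aut_open.
Proof.
move=> U V oU oV s [/oU [l lU] /oV [m mV]]; exists (l ++ m) => t ts.
by split; [apply: lU | apply: mV] => x xl; apply: ts; rewrite mem_cat xl ?orbT.
Qed.

Fact aut_open_bigU (I : Type) (f : I -> set (fieldAut F)) :
  (forall i, aut_open (f i)) -> aut_open (\bigcup_i f i).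
Proof.
move=> of_ s [i _ /of_ [l lf]]; exists l => t ts.
by exists i => //; apply: lf.
Qed.

HB.instance Definition _ :=
  isOpenTopological.Build (fieldAut F) aut_openT aut_openI aut_open_bigU.

Fact aut_openE (U : set (fieldAut F)) : open U = aut_open U.
Proof. by []. Qed.

Fact aut_nbhs (s : fieldAut F) (l : seq E) :
  nbhs s [set t : fieldAut F | forall x, x \in l -> t x = s x].
Proof.
apply: open_nbhs_nbhs; split=> //.
by rewrite aut_openE => t ts; exists l => u ut x xl; rewrite ut // ts.
Qed.

Fact aut_mulg_continuous : continuous (fun p : fieldAut F * fieldAut F => (p.1 * p.2)%g).
Proof.
move=> -[s t] A; rewrite nbhsE => -[U [oU Ust] UA]; move: oU; rewrite aut_openE.
move=> /(_ _ Ust) [l lU].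
exists ([set s' : fieldAut F | forall x, x \in [seq t y | y <- l] -> s' x = s x],
        [set t' : fieldAut F | forall x, x \in l -> t' x = t x]).
  by split; exact: aut_nbhs.
move=> [s' t'] /= [ss' tt']; apply/UA/lU => x xl.
by rewrite /= tt' // ss' //; apply: map_f.
Qed.

Fact aut_invg_continuous : continuous (fun s : fieldAut F => (s^-1)%g).
Proof.
move=> s A; rewrite nbhsE => -[U [oU Us] UA]; move: oU; rewrite aut_openE.
move=> /(_ _ Us) [l lU].
apply: filterS (aut_nbhs s [seq aut_inv s y | y <- l]) => t ts.
apply/UA/lU => x xl /=.
apply: (can_inj (aut_funK t)); rewrite aut_invK ts ?aut_invK //.
exact: map_f.
Qed.

HB.instance Definition _ := Group_Topological_isTopGroup.Build (fieldAut F)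
  aut_mulg_continuous aut_invg_continuous.
End FieldAut.

Section AutInclusion.
Variables (E : fieldType) (F F' : set E) (FF' : F `<=` F').

Fact aut_incl_fix (s : fieldAut F') x : F x -> s x = x.
Proof. by move/FF'; exact: aut_fix. Qed.

Definition aut_incl (s : fieldAut F') : fieldAut F :=
  FieldAut (aut_funK s) (aut_invK s) (aut_incl_fix s).

Fact aut_inclM : {morph aut_incl : s t / (s * t)%g}.
Proof. by move=> s t; apply: fieldAut_ext. Qed.

HB.instance Definition _ :=
  isMultiplicative.Build (fieldAut F') (fieldAut F) aut_incl aut_inclM.
End AutInclusion.

(* [(A, i1, i2)] is the amalgamated product of [G1] and [G2] along [j1] and
   [j2], i.e. their pushout in the category of groups. *)
Definition is_amalgam (G0 G1 G2 A : groupType)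
    (j1 : {multiplicative G0 -> G1}) (j2 : {multiplicative G0 -> G2})
    (i1 : {multiplicative G1 -> A}) (i2 : {multiplicative G2 -> A}) : Prop :=
  (forall c, i1 (j1 c) = i2 (j2 c)) /\
  forall (H : groupType) (h1 : {multiplicative G1 -> H})
    (h2 : {multiplicative G2 -> H}), (forall c, h1 (j1 c) = h2 (j2 c)) ->
  exists h : {multiplicative A -> H},
    [/\ forall a, h (i1 a) = h1 a, forall b, h (i2 b) = h2 b &
    forall h' : {multiplicative A -> H},
      (forall a, h' (i1 a) = h1 a) -> (forall b, h' (i2 b) = h2 b) -> h' =1 h].

Section Groups.
Variables (k : fieldType) (C : correspondence k).
Variables (Omega : fieldType) (j : {rmorphism k -> Omega}).
Variable PQ : kemb (ff_const (kZ C)) j.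

Let E := sf_elt (Einf PQ).
Let inE (S : set Omega) : set E := [set x : E | S (val x)].

Definition Aut_k := @fieldAut E (inE (fimage j)).
Definition G_P := @fieldAut E (inE (fimage (blue_end PQ))).
Definition G_Q := @fieldAut E (inE (fimage (red_end PQ))).
Definition G_PQ := @fieldAut E (inE (fimage PQ)).

Fact k_sub_P : inE (fimage j) `<=` inE (fimage (blue_end PQ)).
Proof. by move=> x [a _ xa]; exists (ff_const (kX C) a); rewrite ?kembP. Qed.
Fact k_sub_Q : inE (fimage j) `<=` inE (fimage (red_end PQ)).
Proof. by move=> x [a _ xa]; exists (ff_const (kY C) a); rewrite ?kembP. Qed.
Fact P_sub_PQ : inE (fimage (blue_end PQ)) `<=` inE (fimage PQ).
Proof. by move=> x [a _ xa]; exists (@fstar _ C a). Qed.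
Fact Q_sub_PQ : inE (fimage (red_end PQ)) `<=` inE (fimage PQ).
Proof. by move=> x [a _ xa]; exists (@gstar _ C a). Qed.

Definition incl_P : {multiplicative G_P -> Aut_k} := aut_incl k_sub_P.
Definition incl_Q : {multiplicative G_Q -> Aut_k} := aut_incl k_sub_Q.
Definition incl_PQ_P : {multiplicative G_PQ -> G_P} := aut_incl P_sub_PQ.
Definition incl_PQ_Q : {multiplicative G_PQ -> G_Q} := aut_incl Q_sub_PQ.

Definition A_PQ : topGroupType :=
  sg_elt (gen_subgroup (range incl_P `|` range incl_Q)).
Definition A_val : A_PQ -> Aut_k := val.
End Groups.

(* Main.v *)
(* Bass-Serre theory.  The image of G_P *_{G_PQ} G_Q in A^{PQ} acts on the edges
   of G_gen by composition, and each letter of a word moves the current edge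
   around its blue or its red vertex; a letter fixing the edge PQ lies in G_PQ.
   A reduced word x therefore traces a walk without backtracking from PQ to
   x(PQ), and as G_gen has no circuit such a walk never returns to an edge: the
   stabilizer of PQ in the amalgam is G_PQ, which embeds in A^{PQ}, so the map
   is injective.  It is open because k(X) is finitely generated over k, so that
   G_P contains the stabilizer of a finite subset of E_oo and is open in
   A^{PQ}. *)
From HB Require Import structures.
Require Import Defs.
From Stdlib Require List.
From mathcomp Require Import all_boot all_order all_algebra all_field.
From mathcomp Require Import all_classical all_analysis.
From mathcomp Require Import zify.

Set Implicit Arguments.
Unset Strict Implicit.
Unset Printing Implicit Defensive.

Import GRing.Theory.
Local Open Scope classical_set_scope.
Local Open Scope ring_scope.

(** * Walks without backtracking *)

Lemma not_NoDup_map (A B : Type) (f : A -> B) (s : seq A) :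
  ~ List.NoDup [seq f x | x <- s] ->
  exists s1 x s2 y s3, s = s1 ++ x :: s2 ++ y :: s3 /\ f x = f y.
Proof.
elim: s => [[]|x s IHs nd]; first exact: List.NoDup_nil.
have [/(List.in_map_iff f) [y [fyx /(@List.in_split A) [s2 [s3 ->]]]]|nx] :=
  pselect (List.In (f x) [seq f x | x <- s]).
  by exists [::], x, s2, y, s3.
have /IHs [s1 [y [s2 [z [s3 [-> fyz]]]]]] : ~ List.NoDup [seq f x | x <- s].
  by move=> ds; apply: nd => /=; apply: List.NoDup_cons.
by exists (x :: s1), y, s2, z, s3.
Qed.

Section Walks.
Variable G : bigraph.
Implicit Types (u v w : vertex G) (d : dart G) (p q : seq (dart G)).

(** Edges are compared without orientation, and the condition is not cyclic: a closed walk may begin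
    and end on the same edge. *)
Definition nonbacktracking p : Prop :=
  forall p1 d d' p2, p = p1 ++ d :: d' :: p2 -> d.1 <> d'.1.

Lemma nonbacktracking_infix p1 p p2 :
  nonbacktracking (p1 ++ p ++ p2) -> nonbacktracking p.
Proof.
move=> nb q1 d d' q2 pE; apply: (nb (p1 ++ q1) d d' (q2 ++ p2)).
by rewrite pE -!catA.
Qed.

Lemma nonbacktracking1 d : nonbacktracking [:: d].
Proof. by case=> [|? []]. Qed.

Lemma nonbacktracking_rcons p d d' :
  nonbacktracking (rcons p d) -> d.1 <> d'.1 ->
  nonbacktracking (rcons (rcons p d) d').
Proof.
move=> nb dd' p1 d1 d2; elim/last_ind=> [|p2 d3 _].
  rewrite -cat_rcons cats1 => /rcons_inj [+ <-].
  by move=> /rcons_inj [_ <-].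
by rewrite -!rcons_cons -rcons_cat => /rcons_inj [/nb].
Qed.

Lemma walk_cat u p q v :
  walk u (p ++ q) v <-> exists w, walk u p w /\ walk w q v.
Proof.
elim: p u => [|d p IHp] u /=; first by split=> [|[w [->]]]; first by exists u.
split=> [[-> /IHp [w [pw qw]]]|[w [[-> pw] qw]]]; first by exists w.
by split=> //; apply/IHp; exists w.
Qed.

Lemma same_edge_ends d d' :
  d.1 = d'.1 -> dsrc d = dsrc d' \/ dsrc d' = dtgt d.
Proof.
by case: d d' => [e b] [e' b'] /= ->; case: b b' => [] [];
  [left|right|right|left].
Qed.

(** The descent step: a repetition inside a walk yields a strictly shorter closed walk that still
    does not backtrack. *)
Definition closed_shortcut p : Prop :=
  exists q w,
    [/\ q <> [::], (size q < size p)%N, nonbacktracking q & walk w q w].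

Lemma same_src_shortcut u p1 d p2 d' p3 v :
  let p := p1 ++ d :: p2 ++ d' :: p3 in
  nonbacktracking p -> walk u p v -> dsrc d = dsrc d' -> closed_shortcut p.
Proof.
move=> p nb /walk_cat [w [_ /= [_ /walk_cat [w' [p2w' [/= d'w' _]]]]]] dd'.
exists (d :: p2), (dsrc d); split=> //.
- by rewrite !size_cat /= size_cat /=; lia.
- exact: (@nonbacktracking_infix p1 (d :: p2) (d' :: p3)).
- by rewrite /= dd' d'w'.
Qed.

(** With equal orientations the sources agree. With opposite ones [d'] starts where [d] ends, so
    [p2] is itself closed; it is nonempty, since otherwise [d] and [d'] would backtrack. *)
Lemma same_edge_shortcut u p1 d p2 d' p3 v :
  let p := p1 ++ d :: p2 ++ d' :: p3 in
  nonbacktracking p -> walk u p v -> d.1 = d'.1 -> closed_shortcut p.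
Proof.
move=> p nb pw dd'; have [|d't] := same_edge_ends dd'.
  exact: (same_src_shortcut nb pw).
have /walk_cat [w [_ /= [_ /walk_cat [w' [p2w' [/= d'w' _]]]]]] := pw.
exists p2, (dtgt d); split=> //.
- by move=> p20; apply: (nb p1 d d' p3) => //; rewrite /p p20.
- by rewrite !size_cat /= size_cat /=; lia.
- apply: (@nonbacktracking_infix (rcons p1 d) p2 (d' :: p3)).
  by rewrite cat_rcons.
- by rewrite -{2}d't d'w'.
Qed.

Hypothesis acyclic : forall p, ~ circuit p.

(** Strong induction on the length: a closed walk without a shortcut repeats no source and no edge,
    so a nonempty one would be a circuit. *)
Lemma nonbacktracking_open p u :
  nonbacktracking p -> walk u p u -> p = [::].
Proof.
have [n] := ubnP (size p); elim: n => // n IHn in p u *.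
rewrite ltnS => pn nb pu; apply: contrapT => p0.
have noshort : ~ closed_shortcut p.
  case=> q [w [q0 /leq_trans /(_ pn) qn nbq qw]].
  exact/q0/(IHn q w qn nbq qw).
apply: (acyclic (p := p)); split => //; first by exists u.
- apply: contrapT => nd.
  have [p1 [d [p2 [d' [p3 [pE dd']]]]]] := not_NoDup_map nd.
  by subst p; exact/noshort/(same_src_shortcut nb pu dd').
- apply: contrapT => nd.
  have [p1 [d [p2 [d' [p3 [pE dd']]]]]] := not_NoDup_map nd.
  by subst p; exact/noshort/(same_edge_shortcut nb pu dd').
Qed.

Lemma nonbacktracking_edges u p1 d p2 d' p3 v :
  let p := p1 ++ d :: p2 ++ d' :: p3 in
  nonbacktracking p -> walk u p v -> d.1 <> d'.1.
Proof.
move=> p nb pw /(same_edge_shortcut nb pw) [q [w [q0 _ nbq qw]]].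
exact/q0/(nonbacktracking_open nbq qw).
Qed.
End Walks.

(** * Amalgams acting on a graph without circuits *)

Lemma multiplicative1 (G H : groupType) (f : {multiplicative G -> H}) :
  f 1%g = 1%g.
Proof. by apply: (@mulgI H (f 1%g)); rewrite -gmulfM !mulg1. Qed.

Section Corestriction.
Variables (G K : groupType) (f : {multiplicative G -> K}) (H : subgroup K).
Hypothesis fH : forall x, sg_set H (f x).

Definition corestrict (x : G) : sg_elt H := exist _ (f x) (mem_set (fH x)).

Fact corestrictM : {morph corestrict : x y / (x * y)%g}.
Proof. by move=> x y; apply: val_inj; rewrite /= gmulfM. Qed.

HB.instance Definition _ :=
  isMultiplicative.Build G (sg_elt H) corestrict corestrictM.
End Corestriction.

Section Amalgam.
Variables (G0 G1 G2 A : groupType).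
Variables (j1 : {multiplicative G0 -> G1}) (j2 : {multiplicative G0 -> G2}).
Variables (i1 : {multiplicative G1 -> A}) (i2 : {multiplicative G2 -> A}).
Hypothesis amalgam : is_amalgam j1 j2 i1 i2.

(** The universal property gives a map from [A] to [H]. Followed by the inclusion it agrees with the
    identity on both factors, so by uniqueness it is the identity. *)
Lemma amalgam_generated (H : subgroup A) :
  (forall a, sg_set H (i1 a)) -> (forall b, sg_set H (i2 b)) ->
  forall x, sg_set H x.
Proof.
move=> H1 H2 x; have [i12 univ] := amalgam.
have [|h [h1 h2 _]] := univ _ (corestrict H1) (corestrict H2).
  by move=> c; apply: val_inj; rewrite /= i12.
have [h0 [_ _ h0_uniq]] := univ _ i1 i2 i12.
pose vh : {multiplicative A -> A} := (val : sg_elt H -> A) \o h.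
have vhE : vh =1 h0 by apply: h0_uniq => [a|b]; rewrite /vh /= ?h1 ?h2.
have idE : idfun =1 h0 by apply: h0_uniq.
have -> : x = val (h x) by rewrite -[LHS]/(idfun x) idE -vhE.
exact: set_mem (valP (h x)).
Qed.

(** The elements whose right multiplication preserves and reflects [S] form a subgroup [T]
    containing both factors, hence all of [A]. *)
Lemma amalgam_ind (S : set A) : S 1%g ->
  (forall x a, S x -> S (x * i1 a)%g) -> (forall x b, S x -> S (x * i2 b)%g) ->
  forall x, S x.
Proof.
move=> S1 SM1 SM2 x.
(* An equivalence, so that [T] is closed under inverses. *)
pose T : set A := [set y | forall z, S (z * y)%g <-> S z].
have T1 : T 1%g by move=> z; rewrite mulg1.
have TF y z : T y -> T z -> T (y / z)%g.
  by move=> Ty Tz w; rewrite -(Tz (w * (y / z))%g) -mulgA mulgVK; exact: Ty.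
have Ti (G : groupType) (i : {multiplicative G -> A}) a :
    (forall x b, S x -> S (x * i b)%g) -> T (i a).
  move=> SM z; split=> [/(SM _ a^-1%g)|/SM //].
  by rewrite -mulgA -gmulfM mulgV multiplicative1 mulg1.
have := @amalgam_generated (Subgroup T1 TF) (fun a => Ti _ i1 a SM1)
  (fun b => Ti _ i2 b SM2) x.
by move=> /(_ 1%g) /=; rewrite mul1g => ->.
Qed.
End Amalgam.

(** * Reduced words and the stabilizer of the base edge *)

Section TreeAction.
Variables (G0 G1 G2 A : groupType).
Variables (j1 : {multiplicative G0 -> G1}) (j2 : {multiplicative G0 -> G2}).
Variables (i1 : {multiplicative G1 -> A}) (i2 : {multiplicative G2 -> A}).
Hypothesis amalgam : is_amalgam j1 j2 i1 i2.

Variables (T : bigraph) (e : A -> edge T).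
Hypothesis acyclic : forall p : seq (dart T), ~ circuit p.
Hypothesis bendM : forall x a, bend (e (x * i1 a)%g) = bend (e x).
Hypothesis rendM : forall x b, rend (e (x * i2 b)%g) = rend (e x).
Hypothesis edgeM : forall x c, e (x * i1 (j1 c))%g = e x.
Hypothesis edge_stab1 :
  forall x a, e (x * i1 a)%g = e x -> exists c, a = j1 c.
Hypothesis edge_stab2 :
  forall x b, e (x * i2 b)%g = e x -> exists c, b = j2 c.

Let i0 c := i1 (j1 c).
Let side (s : bool) : set A := if s then range i1 else range i2.
(** One boolean names both a factor and an orientation: letters on side [s] fix [vtx s x], which is
    the source of the dart [(e x, s)]. *)
Let vtx (s : bool) (x : A) : vertex T :=
  if s then inl (bend (e x)) else inr (rend (e x)).

Let sideM s x y : side s x -> side s y -> side s (x * y)%g.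
Proof.
by case: s => -[a _ <-] [b _ <-]; exists (a * b)%g; rewrite ?gmulfM.
Qed.

Let side_i0 s c : side s (i0 c).
Proof. by case: s; [exists (j1 c)|exists (j2 c)]; rewrite // /i0 amalgam.1. Qed.

Let vtxM s x y : side s y -> vtx s (x * y)%g = vtx s x.
Proof. by case: s => -[a _ <-]; rewrite /vtx ?bendM ?rendM. Qed.

Let edge_stab s x y : side s y -> e (x * y)%g = e x -> exists c, y = i0 c.
Proof.
case: s => -[a _ <-].
  by move=> /edge_stab1 [c ->]; exists c.
by move=> /edge_stab2 [c ->]; exists c; rewrite /i0 amalgam.1.
Qed.

(* [reduced s p x]: [x] is a reduced word whose last letter lies on side [s],
   and [p] is the walk through the translates [e y] for its prefixes [y]; the
   letter [1] stands for the empty word, with [s] arbitrary. *)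
Inductive reduced : bool -> seq (dart T) -> A -> Prop :=
| reduced1 s : reduced s [:: (e 1%g, s)] 1%g
| reducedM s p x y : reduced s p x -> side (~~ s) y -> e (x * y)%g <> e x ->
    reduced (~~ s) (rcons p (e (x * y)%g, ~~ s)) (x * y)%g.

(** A nonempty word gives at least two darts; displaying the first and the last lets
    [nonbacktracking_edges] compare [e 1] with [e x]. *)
Lemma reduced_walk s p x : reduced s p x ->
  exists s0, walk (vtx s0 1%g) p (vtx (~~ s) x) /\
    ((p = [:: (e 1%g, s0)] /\ x = 1%g) \/
     exists q, p = (e 1%g, s0) :: rcons q (e x, s)).
Proof.
elim=> [{}s|{}s {}p {}x y _ [s0 [px pE]] sy exy].
  by exists s; split; [case: s|left].
exists s0; split.
  rewrite -cats1; apply/walk_cat; exists (vtx (~~ s) x); split=> //=.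
  by rewrite -(vtxM x sy) /dsrc /dtgt /= /vtx; case: (s).
by right; case: pE => [[-> _]|[q ->]]; [exists [::]|exists (rcons q (e x, s))].
Qed.

Lemma reduced_last s p x : reduced s p x -> exists q, p = rcons q (e x, s).
Proof.
by case=> [{}s|{}s {}p {}x y _ _ _]; [exists [::]|exists p].
Qed.

Lemma reduced_nonbacktracking s p x : reduced s p x -> nonbacktracking p.
Proof.
elim=> [{}s|{}s {}p {}x y px nbp sy exy]; first exact: nonbacktracking1.
have [q pE] := reduced_last px; rewrite pE in nbp *.
by apply: nonbacktracking_rcons => //= /esym.
Qed.

(** Appending a letter preserves this form: [c] is absorbed into the letter, which then extends the
    word, merges with its last letter or, if it fixes the current edge, becomes the new tail. *)
Lemma reduced_normal_form x :
  exists s p y c, reduced s p y /\ x = (y * i0 c)%g.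
Proof.
pose S : set A := [set x | exists s p y c, reduced s p y /\ x = (y * i0 c)%g].
have Sred s p y : reduced s p y -> S y.
  by move=> py; exists s, p, y, 1%g; rewrite /i0 !multiplicative1 mulg1.
have Sstep s p y z : reduced s p y -> side (~~ s) z -> S (y * z)%g.
  move=> py sz; have [/(edge_stab sz) [c ->]|yz] := pselect (e (y * z)%g = e y).
    by exists s, p, y, c.
  exact: Sred (reducedM py sz yz).
have Sside s y z : side s z -> S y -> S (y * z)%g.
  move=> sz [s' [p [{}y [c [py ->]]]]]; rewrite -mulgA.
  have {sz} := sideM (side_i0 s c) sz; move: (i0 c * z)%g => {}z sz.
  have [ss'|] := eqVneq s (~~ s'); first by apply: Sstep py _; rewrite -ss'.
  move=> /negPf ss'; have {}ss' : s = s' by case: s s' ss' {py sz} => [] [].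
  (* The letter is on the side [s']. The empty word may be relabelled with the opposite side;
     otherwise the letter joins [y'], and their product is appended to the shorter prefix. *)
  case: py ss' => [{}s'|{}s' {}p {}y y' py sy' _] ss'; subst s.
    by apply: (Sstep (~~ s')); [exact: reduced1|rewrite negbK].
  by rewrite -mulgA; apply: Sstep py _; exact: sideM.
apply: (amalgam_ind amalgam (S := S)) => [|y a|y b].
- exact: Sred (reduced1 true).
- by apply: (Sside true); exists a.
- by apply: (Sside false); exists b.
Qed.

(** The tail [c] does not move the edge, so a nonempty reduced word in the stabilizer would trace a
    walk that starts and ends on one edge. *)
Theorem edge_stabilizer x : e x = e 1%g -> exists c, x = i1 (j1 c).
Proof.
have [s [p [y [c [py ->]]]]] := reduced_normal_form x.
rewrite edgeM => ey; have [s0 [pw [[_ ->]|[q pE]]]] := reduced_walk py.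
  by exists c; rewrite mul1g.
have nb := reduced_nonbacktracking py; rewrite pE -cats1 in nb pw.
by case: (nonbacktracking_edges acyclic (p1 := [::]) (p3 := [::]) nb pw).
Qed.
End TreeAction.

(** * Finite generation of the function field *)

Section Subfields.
Variables (L : fieldType) (S : set L) (subS : is_subfield S).

Lemma subfield1 : S 1. Proof. by case: subS. Qed.

Lemma subfieldB x y : S x -> S y -> S (x - y).
Proof. by case: subS => _ + _; apply. Qed.

Lemma subfield_div x y : S x -> S y -> S (x / y).
Proof. by case: subS => _ _; apply. Qed.

Lemma subfieldM x y : S x -> S y -> S (x * y).
Proof.
move=> Sx Sy; rewrite -[y]invrK -[y^-1]mul1r.
by apply/subfield_div/subfield_div => //; exact: subfield1.
Qed.
End Subfields.

(** The sheaf condition for the cover indexed by [False]: gluing is unique and there is nothing to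
    glue. *)
Lemma sec_empty (X : ringedSpace) (W : opens X) (s t : sec W) :
  oset W `<=` set0 -> s = t.
Proof.
move=> W0.
have [||u [_ uu]] := @sheafP X W False (fun=> W) (fun=> @subset_refl _ W) _
  (fun i : False => match i with end).
- by move=> x /W0.
- by case.
have -> : s = u by apply/esym/uu; case.
by apply: uu; case.
Qed.

Section FunctionFields.
Variables (k : fieldType) (X : kScheme k) (KX : function_field X).

Lemma unit_locus_open (U : opens X) (s : sec U) :
  open [set y | oset U y /\ unit_at s y].
Proof.
rewrite openE => y [Uy [V [VU [Vy sV]]]].
rewrite /interior nbhsE; exists (oset V).
  by split=> //; exact: oset_open.
by move=> z Vz; split; [exact (VU z Vz) | exists V, VU].
Qed.

(* Otherwise the section equal to [1] on [U] and to [0] on [V] would have germ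
   [1] along [U] and [0] along [V]. *)
Lemma opens_meet (U V : opens X) :
  oset U !=set0 -> oset V !=set0 -> oset U `&` oset V !=set0.
Proof.
move=> nU nV; apply: contrapT => /nonemptyPn UV0.
pose F (b : bool) := if b then U else V.
pose UV := Opens (openU (oset_open U) (oset_open V)).
have FUV b : F b `<=` UV by case: b => x; [left|right].
have [|b c W Wb Wc|t [tF _]] := @sheafP X UV bool F FUV _ (fun b => b%:R).
- by move=> x [Ux|Vx]; [exists true|exists false].
- case: b c Wb Wc => [] [] Wb Wc; rewrite !rmorph_nat //;
    apply: sec_empty => x Wx; rewrite -UV0.
    by split; [exact (Wb x Wx) | exact (Wc x Wx)].
  by split; [exact (Wc x Wx) | exact (Wb x Wx)].
have nUV : oset UV !=set0 by case: nU => x Ux; exists x; left.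
have nF b : oset (F b) !=set0 by case: b.
have germF (b : bool) : germ KX nUV t = b%:R.
  by rewrite -(germ_res KX nUV (nF b) (FUV b)) tF rmorph_nat.
have /eqP := germF true; rewrite (germF false).
by rewrite eq_sym oner_eq0.
Qed.

Lemma germ_const (U : opens X) (nU : oset U !=set0) a :
  germ KX nU (str X U a) = ff_const KX a.
Proof.
have h : oset U `<=` fullo X by [].
by rewrite -(str_res h) (germ_res KX (fullo_neq0 KX) nU h).
Qed.

Lemma unit_germ_neq0 (U : opens X) (nU : oset U !=set0) (s : sec U) x :
  unit_at s x -> germ KX nU s != 0.
Proof.
move=> [V [VU [Vx [t st]]]]; have nV : oset V !=set0 by exists x.
have gst : germ KX nU s * germ KX nV t = 1.
  by rewrite -(germ_res KX nU nV VU) -rmorphM st rmorph1.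
by apply/eqP => s0; move/eqP: gst; rewrite s0 mul0r eq_sym oner_eq0.
Qed.

(** Represent [z] by a section [t] on [V] and shrink to a unit locus of some [s] inside both [U] and
    [V]; there [t] times a power of [s] extends to [U]. *)
Lemma affine_germ_fraction (U : opens X) (nU : oset U !=set0) (z : KX) :
  affine_open U -> exists a b : sec U, z = germ KX nU a / germ KX nU b.
Proof.
move=> [_ base loc]; have [V [nV [t ->]]] := germ_surj z.
have [x [Ux Vx]] := opens_meet nU nV.
have [s [sx sV]] : exists s : sec U, unit_at s x /\
    [set y | oset U y /\ unit_at s y] `<=` oset U `&` oset V.
  apply: (base (Opens (openI (oset_open U) (oset_open V)))) => //.
  by move=> y [].
pose D := Opens (unit_locus_open s).
have DU : D `<=` U by move=> y [].
have DV : D `<=` V by move=> y /sV [].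
have nD : oset D !=set0 by exists x.
have [/(_ (res DV t)) [n [a ta]] _] := loc s D DU erefl.
exists a, (s ^+ n); rewrite -(germ_res KX nV nD DV) rmorphXn.
rewrite -(germ_res KX nU nD DU a) ta rmorphM rmorphXn (germ_res KX nU nD DU).
rewrite mulfK//.
by rewrite expf_neq0// (unit_germ_neq0 _ sx).
Qed.

(** The germs of algebra generators of an affine open suffice, since every element is a quotient of
    germs of its sections. *)
Lemma function_field_finitely_generated :
  finite_type X ->
  exists l : seq KX, forall S : set KX, is_subfield S ->
    (forall a, S (ff_const KX a)) -> (forall x, x \in l -> S x) ->
    forall x, S x.
Proof.
move=> [_ ft]; have [x _] := fullo_neq0 KX.
have [U [Ux affU [l lgen]]] := ft x; have nU : oset U !=set0 by exists x.
exists [seq germ KX nU s | s <- l] => S subS Sk Sl z.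
have SU s : S (germ KX nU s).
  apply: (lgen [set s | S (germ KX nU s)]) => /=.
  - by rewrite rmorph1; exact: subfield1.
  - by move=> a b Sa Sb; rewrite rmorphB; exact: subfieldB.
  - by move=> a b Sa Sb; rewrite rmorphM; exact: subfieldM.
  - by move=> a; rewrite germ_const.
  - by move=> a al; apply/Sl/map_f.
by have [a [b ->]] := affine_germ_fraction nU z affU; exact: subfield_div.
Qed.
End FunctionFields.

(** * The action on the generic graph *)

Section SubfieldCorestriction.
Variables (K L : fieldType) (f : {rmorphism K -> L}) (F : subfield L).
Hypothesis fF : forall x, sf_set F (f x).

Definition sf_corestrict (x : K) : sf_elt F := exist _ (f x) (mem_set (fF x)).

Fact sf_corestrict_zmod : zmod_morphism sf_corestrict.
Proof. by move=> x y; apply: val_inj; rewrite /= rmorphB. Qed.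

Fact sf_corestrict_monoid : monoid_morphism sf_corestrict.
Proof.
by split=> [|x y]; apply: val_inj; rewrite /= ?rmorph1 ?rmorphM.
Qed.

HB.instance Definition _ :=
  GRing.isZmodMorphism.Build K (sf_elt F) sf_corestrict sf_corestrict_zmod.
HB.instance Definition _ :=
  GRing.isMonoidMorphism.Build K (sf_elt F) sf_corestrict sf_corestrict_monoid.
End SubfieldCorestriction.

Section FieldAutomorphisms.
Variables (E : fieldType) (F F' : set E).

Lemma fieldAut_fixing (s : fieldAut F) : (forall x, F' x -> s x = x) ->
  exists t : fieldAut F', t =1 s.
Proof. by move=> sF'; exists (FieldAut (aut_funK s) (aut_invK s) sF'). Qed.

Lemma sg_aut_open (H : subgroup (fieldAut F)) (U : set (sg_elt H)) :
  open U <-> forall s, U s -> exists l : seq E, forall t : sg_elt H,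
    (forall x, x \in l -> val t x = val s x) -> U t.
Proof.
split=> [|oU].
  rewrite sg_open => -[V + <-] s Vs; rewrite aut_openE => /(_ _ Vs) [l lV].
  by exists l => t /lV.
rewrite sg_open.
(* Openness in the initial topology requires an open set with trace [U]; the largest candidate is
   taken. *)
pose V : set (fieldAut F) :=
  \bigcup_(W in [set W | open W /\ val @^-1` W `<=` U]) W.
exists V; first by apply: bigcup_open => W [].
apply/seteqP; split=> [t [W [_ WU] /WU]//|s Us].
have [l lU] := oU s Us.
exists [set t : fieldAut F | forall x, x \in l -> t x = val s x] => //.
split; last by move=> t /lU.
by rewrite aut_openE => t ts; exists l => u ut x xl; rewrite ut ?ts.
Qed.
End FieldAutomorphisms.

Lemma open_translate (G : topGroupType) (g : G) (U : set G) :
  open U -> open [set x | U (g * x)%g].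
Proof.
move=> oU; apply: (@open_comp _ _ (fun x => (g * x)%g)) => // x _.
apply: (@continuous_comp _ _ _ (pair g) (fun p : G * G => (p.1 * p.2)%g)).
  by apply: cvg_pair; [exact: cvg_cst|exact: cvg_id].
exact: mulg_continuous.
Qed.

Lemma kemb_ext (k K L : fieldType) (i : {rmorphism k -> K})
    (j : {rmorphism k -> L}) (f g : kemb i j) : f =1 g -> f = g.
Proof.
case: f g => f fi [g gi] /= /rmorphism_ext fg; subst g.
by congr Kemb; exact: Prop_irrelevance.
Qed.

Section Connected.
Variables (G : bigraph) (u : vertex G).

(** [component] tests an edge at its blue end, so turning about a red vertex takes two darts, along
    [e] and back along [e']. *)
Lemma connected_same_rend (e e' : edge G) : rend e' = rend e ->
  connected_to u (inl (bend e)) -> connected_to u (inl (bend e')).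
Proof.
move=> ee' [p pu]; exists (p ++ [:: (e, true); (e', false)]).
by apply/walk_cat; exists (inl (bend e)); rewrite /= /dsrc /dtgt /= ee'.
Qed.
End Connected.

Section GenericGraphAction.
Variables (k : fieldType) (C : correspondence k).
Variables (Omega : fieldType) (j : {rmorphism k -> Omega}).
Variable PQ : kemb (ff_const (kZ C)) j.

Let E := sf_elt (Einf PQ).

Fact PQ_in_Einf z : sf_set (Einf PQ) (PQ z).
Proof. by move=> S [_]; apply; exists z. Qed.

Definition PQ_E : {rmorphism kZ C -> E} := sf_corestrict PQ_in_Einf.

Lemma in_PQ (z : kZ C) (x : E) : PQ z = val x -> x = PQ_E z.
Proof. by move=> zx; apply: val_inj. Qed.

Fact translate_const (s : Aut_k PQ) a :
  (val \o (s \o PQ_E)) (ff_const (kZ C) a) = j a.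
Proof. by rewrite /= aut_fix /= ?kembP //; exists a. Qed.

Definition translate (s : Aut_k PQ) : edge (Ggen_full C j) :=
  Kemb (translate_const s).

Lemma translate1 : translate 1%g = PQ.
Proof. exact: kemb_ext. Qed.

(** In the product [a] acts first, and it fixes the image of k(X) pointwise. *)
Lemma translate_bend s (a : G_P PQ) :
  bend (translate (s * incl_P PQ a)%g) = bend (translate s).
Proof.
apply: kemb_ext => x /=; rewrite (aut_fix a) //; by exists x.
Qed.

Lemma translate_rend s (b : G_Q PQ) :
  rend (translate (s * incl_Q PQ b)%g) = rend (translate s).
Proof.
apply: kemb_ext => x /=; rewrite (aut_fix b) //; by exists x.
Qed.

Lemma translate_edge s (c : G_PQ PQ) :
  translate (s * incl_P PQ (incl_PQ_P PQ c))%g = translate s.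
Proof.
apply: kemb_ext => x /=; rewrite (aut_fix c) //; by exists x.
Qed.

(** Cancel the injective map [s]; what remains places [t] in [G_PQ]. *)
Lemma translate_stab s t : translate (s * t)%g = translate s ->
  forall x, fimage PQ (val x) -> t x = x.
Proof.
move=> /(congr1 (fun e : kemb _ _ => kemb_fun e)) st x [z _ /in_PQ ->].
have /(congr1 (fun f : {rmorphism _ -> _} => f z)) /= := st.
by move=> /val_inj /(can_inj (aut_funK s)).
Qed.

Lemma translate_stab_P s (a : G_P PQ) :
  translate (s * incl_P PQ a)%g = translate s -> exists c, a = incl_PQ_P PQ c.
Proof.
move=> /translate_stab /(fieldAut_fixing (s := a)) [c ca].
by exists c; apply: fieldAut_ext => x; rewrite /= ca.
Qed.

Lemma translate_stab_Q s (b : G_Q PQ) :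
  translate (s * incl_Q PQ b)%g = translate s -> exists c, b = incl_PQ_Q PQ c.
Proof.
move=> /translate_stab /(fieldAut_fixing (s := b)) [c cb].
by exists c; apply: fieldAut_ext => x; rewrite /= cb.
Qed.

(** The list consists of the images of field generators of k(X): the elements on which [s] is
    trivial form a subfield containing the constants. *)
Lemma G_P_contains_stabilizer : exists l : seq E, forall s : Aut_k PQ,
  (forall x, x \in l -> s x = x) -> exists a : G_P PQ, incl_P PQ a = s.
Proof.
have [_ ft _ _ _] := cX_curve C.
have [l lgen] := function_field_finitely_generated (kX C) ft.
exists [seq PQ_E (fstar C x) | x <- l] => s sl.
have sP x : s (PQ_E (fstar C x)) = PQ_E (fstar C x).
  apply: (lgen [set x | s (PQ_E (fstar C x)) = PQ_E (fstar C x)]) => /=.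
  - split=> /= [|y z sy sz|y z sy sz]; first by rewrite !rmorph1.
      by rewrite !rmorphB sy sz.
    by rewrite !fmorph_div sy sz.
  - move=> a; apply: aut_fix; exists a => //.
    by rewrite /= (pullback_const (@cf_kmor _ C) (@fstarP _ C)) kembP.
  - by move=> y yl; apply/sl/map_f.
have [|a as_] := @fieldAut_fixing _ _ [set x | fimage (blue_end PQ) (val x)] s.
  by move=> x [y _ /in_PQ ->].
by exists a; apply: fieldAut_ext.
Qed.
End GenericGraphAction.

(** * The comparison map from the amalgam to [A_PQ] *)

Section AmalgamToAut.
Variables (k : fieldType) (C : correspondence k).
Variables (Omega : fieldType) (j : {rmorphism k -> Omega}).
Variable PQ : kemb (ff_const (kZ C)) j.
Variables (Gam : topGroupType).
Variables (iP : {multiplicative G_P PQ -> Gam}).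
Variables (iQ : {multiplicative G_Q PQ -> Gam}).
Hypothesis amalgam : is_amalgam (incl_PQ_P PQ) (incl_PQ_Q PQ) iP iQ.

Lemma amalgam_to_A_PQ : exists phi : {multiplicative Gam -> A_PQ PQ},
  (forall s, A_val (phi (iP s)) = incl_P PQ s) /\
  (forall s, A_val (phi (iQ s)) = incl_Q PQ s).
Proof.
have PA a : gen_subgroup_set (range (incl_P PQ) `|` range (incl_Q PQ))
    (incl_P PQ a) by apply: sub_gen_smallest; left; exists a.
have QA b : gen_subgroup_set (range (incl_P PQ) `|` range (incl_Q PQ))
    (incl_Q PQ b) by apply: sub_gen_smallest; right; exists b.
have [|phi [phiP phiQ _]] := amalgam.2 (A_PQ PQ)
  (corestrict (H := gen_subgroup _) PA) (corestrict (H := gen_subgroup _) QA).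
  by move=> c; apply: val_inj; apply: fieldAut_ext.
by exists phi; split=> s; rewrite ?phiP ?phiQ.
Qed.

Variable phi : {multiplicative Gam -> A_PQ PQ}.
Hypothesis phiP : forall s, A_val (phi (iP s)) = incl_P PQ s.
Hypothesis phiQ : forall s, A_val (phi (iQ s)) = incl_Q PQ s.

Lemma A_valM : {morph @A_val _ _ _ _ PQ : x y / (x * y)%g}.
Proof. by []. Qed.

(** The image is a subgroup containing the generators of [A_PQ]. *)
Lemma amalgam_map_surjective y : exists x, phi x = y.
Proof.
have ySP : gen_subgroup_set (range (incl_P PQ) `|` range (incl_Q PQ)) (val y).
  exact: set_mem (valP y).
have [|x xy] := ySP [set s | exists x, A_val (phi x) = s]; last first.
  by exists x; apply: val_inj.
split=> [|s [[a _ <-]|[b _ <-]]]; [|by exists (iP a)|by exists (iQ b)].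
split=> [|_ _ [x <-] [x' <-]]; first by exists 1%g; rewrite multiplicative1.
exists (x / x')%g; rewrite gmulfM A_valM; congr (_ * _)%g.
apply: (@mulgI _ (A_val (phi x'))).
by rewrite -A_valM -gmulfM !mulgV multiplicative1.
Qed.

Lemma amalgam_map_injective :
  (forall p : seq (dart (Ggen PQ)), ~ circuit p) -> injective phi.
Proof.
move=> acyclic.
pose t x := translate (A_val (phi x)).
have tP x a : bend (t (x * iP a)%g) = bend (t x).
  by rewrite /t gmulfM A_valM phiP translate_bend.
have tQ x b : rend (t (x * iQ b)%g) = rend (t x).
  by rewrite /t gmulfM A_valM phiQ translate_rend.
have t1 : t 1%g = PQ by rewrite /t multiplicative1 translate1.
pose conn (e : edge (Ggen_full C j)) :=
  connected_to (inl (bend (PQ : edge (Ggen_full C j)))) (inl (bend e)).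
(* Only the component of [PQ] is known to be acyclic, so the translates must be shown to stay in
   it. *)
have tcomp x : conn (t x).
  apply: (amalgam_ind amalgam (S := fun x => conn (t x))) => [|y a|y b];
    rewrite /conn.
  - by rewrite t1; exists [::].
  - by rewrite tP.
  - exact/connected_same_rend/tQ.
pose e x : edge (Ggen PQ) := exist conn (t x) (tcomp x).
have eE x y : e x = e y <-> t x = t y.
  by split=> [/(congr1 sval)//|xy]; exact: eq_exist.
have stab x : e x = e 1%g -> exists c, x = iP (incl_PQ_P PQ c).
  apply: (edge_stabilizer amalgam acyclic) => [y a|y b|y c|y a|y b].
  - exact/eq_exist/tP.
  - exact/eq_exist/tQ.
  - by apply/eE; rewrite /t gmulfM A_valM phiP translate_edge.
  - by move/eE; rewrite /t gmulfM A_valM phiP => /translate_stab_P.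
  - by move/eE; rewrite /t gmulfM A_valM phiQ => /translate_stab_Q.
(* A kernel element fixes the edge [PQ], hence comes from some [c] in [G_PQ], and [phi] sends it to
   [c] itself as an automorphism. *)
have ker x : phi x = 1%g -> x = 1%g.
  move=> x1; have [|c xc] := stab x.
    by apply/eE; rewrite /t x1 multiplicative1.
  have c1 : c = 1%g.
    apply: fieldAut_ext => z.
    have /(congr1 (fun s : Aut_k PQ => s z)) := phiP (incl_PQ_P PQ c).
    by rewrite -xc x1.
  by rewrite xc c1 !multiplicative1.
move=> x y xy; apply: (@mulIg Gam y^-1%g); rewrite mulgV; apply: ker.
by rewrite gmulfM xy -gmulfM mulgV multiplicative1.
Qed.

(** Since [iP] is open, continuity at [g] can be tested on the coset of [g] by the image of [iP],
    where [phi] is a translate of [incl_P]. *)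
Lemma amalgam_map_continuous : open_embedding iP -> continuous phi.
Proof.
move=> [_ _ oiP]; apply/continuousP => W; rewrite sg_aut_open => oW.
rewrite openE => g Wg; pose V : set (G_P PQ) := [set s | W (phi (g * iP s)%g)].
have oV : open V.
  rewrite aut_openE => s Vs; have [l lW] := oW _ Vs; exists l => t ts.
  apply: lW => x xl; rewrite !gmulfM.
  have := congr1 (val (phi g)) (ts x xl).
  by rewrite -[t x]/(incl_P PQ t x) -[s x]/(incl_P PQ s x) -!phiP.
rewrite /interior nbhsE.
exists [set x | (iP @` V) (g^-1 * x)%g].
  split; first exact/open_translate/oiP.
  exists 1%g; rewrite ?multiplicative1 ?mulVg //.
  by rewrite /V /= multiplicative1 mulg1.
by move=> x [s Vs gx]; move: Vs; rewrite /V /= gx mulVKg.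
Qed.

(** Near [phi g], agreement on [l0] forces the quotient [w] into [G_P], and agreement on [l] makes
    it so close to [1] that it lifts into the translate of [U]. *)
Lemma amalgam_map_open : continuous iP -> forall U, open U -> open (phi @` U).
Proof.
move=> ciP U oU; apply/sg_aut_open => _ [g Ug <-].
have [l0 l0P] := G_P_contains_stabilizer PQ.
have : open (iP @^-1` [set x | U (g * x)%g]).
  by move/continuousP: ciP; apply; exact: open_translate.
rewrite aut_openE => /(_ 1%g) [|l lU].
  by rewrite /= multiplicative1 mulg1.
exists (l0 ++ l) => z zg.
pose w : Aut_k PQ := ((A_val (phi g))^-1 * A_val z)%g.
have wfix x : x \in l0 ++ l -> w x = x.
  by move=> /zg zx; rewrite /w /= /A_val zx; exact: aut_funK.
have [|a aw] := l0P w; first by move=> x xl; rewrite wfix// mem_cat xl.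
exists (g * iP a)%g.
  apply: lU => x xl; rewrite -[a x]/(incl_P PQ a x) aw wfix//.
  by rewrite mem_cat xl orbT.
apply: val_inj; rewrite -[LHS]/(A_val (phi (g * iP a)%g)) gmulfM A_valM phiP aw.
exact: mulVKg.
Qed.
End AmalgamToAut.

(** The amalgam is any model [Gam] of the pushout, its topology being pinned down by the open
    embeddings [iP] and [iQ]. *)
Theorem proposition5p19 (k : fieldType) (C : correspondence k)
  (hmin : minimal C) (hcore : without_core C)
  (hZ : hyperbolic (cZ C) \/
        exists (p : nat) (i : {rmorphism 'F_p -> k}),
          prime p /\ is_algebraic_closure i)
  (Omega : closedFieldType) (j : {rmorphism k -> Omega})
  (hOmega : has_trdeg (fimage j) setT 1)
  (PQ : kemb (ff_const (kZ C)) j)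
  (htree : is_tree (Ggen PQ))
  (Gam : topGroupType)
  (iP : {multiplicative G_P PQ -> Gam}) (iQ : {multiplicative G_Q PQ -> Gam})
  (hamalgam : is_amalgam (incl_PQ_P PQ) (incl_PQ_Q PQ) iP iQ)
  (hiP : open_embedding iP) (hiQ : open_embedding iQ) :
  exists phi : {multiplicative Gam -> A_PQ PQ},
    [/\ forall s : G_P PQ, A_val (phi (iP s)) = incl_P PQ s,
        forall s : G_Q PQ, A_val (phi (iQ s)) = incl_Q PQ s
      & homeomorphism phi].
Proof.
have [phi [phiP phiQ]] := amalgam_to_A_PQ hamalgam.
have [_ _ acyclic] := htree.
exists phi; split=> [//|//|]; split.
- rewrite -setTT_bijective; split=> [//|x y _ _|y _].
    exact: (amalgam_map_injective hamalgam phiP phiQ acyclic).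
  by have [x <-] := amalgam_map_surjective phiP phiQ y; exists x.
- exact: amalgam_map_continuous phiP hiP.
- by have [_ ciP _] := hiP; exact: amalgam_map_open phiP ciP.
Qed.
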